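(* Let $F:\mathbb{R}^n\to\mathbb{R}^m$ be smooth, let $D\subset\mathbb{R}^m$ be a closed set that is Clarke regular at every one of its points, and let $S:\mathbb{R}^n\rightrightarrows\mathbb{R}^m$ be given by $S(x)=F(x)-D=\{F(x)-d\mid d\in D\}$. Suppose $(\bar x,\bar u)\in\mathrm{gph}(S)$. (Then $S^{-1}(u)$ consists of all $x$ satisfying the constraint system $F(x)-u\in D$, with $u$ as a parameter.) Suppose $H:\mathbb{R}^m\rightrightarrows\mathbb{R}^n$ is a prefan such that for all $p\in\mathbb{R}^m\setminus\{0\}$ there exists $q\in-H(-p)$ such that $\nabla F(\bar x)q-p\in T_D(F(\bar x)-\bar u)$. Then $S^{-1}:\mathbb{R}^m\rightrightarrows\mathbb{R}^n$ is pseudo strictly $H$-differentiable at $(\bar u,\bar x)$.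
   Context: ''Smooth'' means continuously differentiable; $\nabla F(\bar x)$ is the $m\times n$ Jacobian matrix. A set-valued map $S:\mathbb{R}^n\rightrightarrows\mathbb{R}^m$ assigns to each $x$ a subset $S(x)\subset\mathbb{R}^m$; its graph is $\mathrm{gph}(S)=\{(x,y)\mid y\in S(x)\}$ and its inverse is $S^{-1}(y)=\{x\mid y\in S(x)\}$. $\mathbb{B}$ is the closed unit ball. $H:\mathbb{R}^m\rightrightarrows\mathbb{R}^n$ is positively homogeneous if $0\in H(0)$ and $H(kw)=kH(w)$ for all $k>0$ and all $w$. For a real $\delta>0$, $(H+\delta)(w):=H(w)+\delta\|w\|\mathbb{B}$. $H$ is a prefan if it is positively homogeneous, $H(p)$ is nonempty, convex and compact for all $p$, and $\sup_{\|w\|\le1}\sup_{z\in H(w)}\|z\|$ is finite. A map $R:\mathbb{R}^m\rightrightarrows\mathbb{R}^n$ is pseudo strictly $H$-differentiable at $(\bar u,\bar x)\in\mathrm{gph}(R)$ if for any $\delta>0$ there are neighborhoods $U_\delta$ of $\bar u$ and $V_\delta$ of $\bar x$ such that $R(u)\cap V_\delta\subset R(u')+(H+\delta)(u-u')$ for all $u,u'\in U_\delta$. For a set $C$ and $\bar z\in C$, the tangent (contingent) cone $T_C(\bar z)$ is the set of $w$ such that $(z_i-\bar z)/\tau_i\to w$ for some $z_i\to\bar z$, $z_i\in C$, $\tau_i\searrow0$. A closed set $C\subset\mathbb{R}^N$ is Clarke regular at $\bar z\in C$ if $T_C:C\rightrightarrows\mathbb{R}^N$ is inner semicontinuous at $\bar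 z$: for every $\rho>0$ and $\epsilon>0$ there is a neighborhood $V$ of $\bar z$ such that $T_C(\bar z)\cap\rho\mathbb{B}\subset T_C(z)+\epsilon\mathbb{B}$ for all $z\in C\cap V$. *)

(* Defs.v *)
From HB Require Import structures.
From mathcomp Require Import all_boot all_order all_algebra.
From mathcomp Require Import all_classical all_reals all_analysis.

Set Implicit Arguments.
Unset Strict Implicit.
Unset Printing Implicit Defensive.

Import Order.TTheory GRing.Theory Num.Theory.
Import numFieldNormedType.Exports.

Local Open Scope classical_set_scope.
Local Open Scope ring_scope.

(* R^n is 'rV[R]_n. The library norm `|x| on 'rV[R]_n is the maximum norm, so
   the Euclidean norm is introduced here; both induce the same topology, and
   nbhs, closed, compact, convergence and differentiability below are the
   library's. *)
Definition enorm (R : realType) (n : nat) (x : 'rV[R]_n) : R :=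
  Num.sqrt (\sum_(i < n) x ord0 i ^+ 2).

Definition unit_ball (R : realType) (n : nat) : set 'rV[R]_n :=
  [set x | enorm x <= 1].
Arguments unit_ball {R n}.

Definition set_add (V : zmodType) (A B : set V) : set V :=
  [set z | exists x y, [/\ A x, B y & z = x + y]].

Definition set_scale (R : realType) (V : lmodType R) (k : R) (A : set V) :
  set V := [set k *: x | x in A].

(* A set-valued map from X to Y is a function X -> set Y. *)
Definition gph (X Y : Type) (S : X -> set Y) : set (X * Y) :=
  [set xy | S xy.1 xy.2].

Definition set_inv (X Y : Type) (S : X -> set Y) : Y -> set X :=
  fun y => [set x | S x y].

(* In the library's row-vector convention 'J F x is the n x m transpose of the
   usual Jacobian matrix, and it acts on vectors by q |-> q *m 'J F x. *)
Definition smooth (R : realType) (n m : nat) (F : 'rV[R]_n -> 'rV[R]_m) :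
  Prop :=
  (forall x, differentiable F x) /\ continuous (fun x => 'J F x).

Definition pos_homogeneous (R : realType) (m n : nat)
    (H : 'rV[R]_m -> set 'rV[R]_n) : Prop :=
  H 0 0 /\ forall (k : R) (w : 'rV[R]_m), 0 < k -> H (k *: w) = set_scale k (H w).

Definition enlarge (R : realType) (m n : nat) (H : 'rV[R]_m -> set 'rV[R]_n)
    (delta : R) : 'rV[R]_m -> set 'rV[R]_n :=
  fun w => set_add (H w) (set_scale (delta * enorm w) unit_ball).

(* the extended real sup_{|w| <= 1} sup_{z in H(w)} |z| *)
Definition outer_norm (R : realType) (m n : nat)
    (H : 'rV[R]_m -> set 'rV[R]_n) : \bar R :=
  ereal_sup [set ereal_sup [set (enorm z)%:E | z in H w] | w in unit_ball].

Definition prefan (R : realType) (m n : nat) (H : 'rV[R]_m -> set 'rV[R]_n) :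
  Prop :=
  [/\ pos_homogeneous H,
      forall p, [/\ H p !=set0, convex_set (H p) & compact (H p)]
    & (outer_norm H < +oo)%E].

Definition pseudo_strictly_differentiable (R : realType) (m n : nat)
    (H Q : 'rV[R]_m -> set 'rV[R]_n) (ubar : 'rV[R]_m) (xbar : 'rV[R]_n) :
  Prop :=
  gph Q (ubar, xbar) /\
  forall delta : R, 0 < delta ->
    exists (U : set 'rV[R]_m) (V : set 'rV[R]_n),
      [/\ nbhs ubar U, nbhs xbar V
        & forall u u', U u -> U u' ->
            Q u `&` V `<=` set_add (Q u') (enlarge H delta (u - u'))].

Definition tangent_cone (R : realType) (N : nat) (C : set 'rV[R]_N)
    (zbar : 'rV[R]_N) : set 'rV[R]_N :=
  [set w | exists (z : nat -> 'rV[R]_N) (tau : nat -> R),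
     [/\ forall i, C (z i), z @ \oo --> zbar,
         forall i, 0 < tau i, tau @ \oo --> (0 : R)
       & (fun i => (tau i)^-1 *: (z i - zbar)) @ \oo --> w]].

Definition clarke_regular (R : realType) (N : nat) (C : set 'rV[R]_N)
    (zbar : 'rV[R]_N) : Prop :=
  forall rho eps : R, 0 < rho -> 0 < eps ->
    exists2 V : set 'rV[R]_N, nbhs zbar V &
      forall z, (C `&` V) z ->
        tangent_cone C zbar `&` set_scale rho unit_ball
          `<=` set_add (tangent_cone C z) (set_scale eps unit_ball).

(* Main.v *)
(* Write p = u' - u and pick q in -H(-p) with [J q - p] tangent to D at
   F xbar - ubar. By Clarke regularity this vector is almost tangent to D at
   every nearby point of D, so from any (x, z) with z in D one can move x by
   tau q and z inside D while F x - z changes by tau p + O(eps tau |p|). Given a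
   solution x0 for the parameter u, minimize
     |F x - z - u - t p| + c |x - x0 - t q| - d t |p|
   over t in [0, 1], z in D and (x, z) in a compact neighborhood. The value at
   (0, x0, F x0 - u) is 0, which keeps the minimizer in the interior. If t < 1, a
   step in the direction p decreases the value since eps < d; if t = 1 and the
   residual is nonzero, a step in the direction of minus the residual decreases
   it since eps + c k < 1, where k bounds H. Hence the minimizer solves the system
   for u' and is within (d / c) |p| of x0 + q; d / c is chosen small with delta. *)

Require Import Defs.
From HB Require Import structures.
From mathcomp Require Import all_boot all_order all_algebra.
From mathcomp Require Import all_classical all_reals all_analysis.
From mathcomp Require Import ring lra.

Set Implicit Arguments.
Unset Strict Implicit.
Unset Printing Implicit Defensive.

Import Order.TTheory GRing.Theory Num.Theory.
Import numFieldNormedType.Exports.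

Local Open Scope classical_set_scope.
Local Open Scope ring_scope.

(** * Maximum and Euclidean norms, and a linear bound for prefans *)

Lemma le_coord_mx_norm (R : realType) (m n : nat) (A : 'M[R]_(m, n)) i j :
  `|A i j| <= `|A|.
Proof.
rewrite [leRHS]/Num.norm /= mx_normrE; apply/bigmax_geP; right.
by exists (i, j).
Qed.

Lemma mx_norm_le (R : realType) (m n : nat) (A : 'M[R]_(m, n)) (c : R) :
  0 <= c -> (forall i j, `|A i j| <= c) -> `|A| <= c.
Proof.
move=> c0 Ac; rewrite [leLHS]/Num.norm /= mx_normrE; apply/bigmax_leP.
by split=> // -[i j] _; exact: Ac.
Qed.

Lemma mx_norm_mulmx (R : realType) (m n p : nat) (A : 'M[R]_(m, n))
    (B : 'M[R]_(n, p)) : `|A *m B| <= n%:R * `|A| * `|B|.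
Proof.
apply: mx_norm_le => [|i j]; first by rewrite !mulr_ge0.
rewrite mxE (le_trans (ler_norm_sum _ _ _))//.
rewrite -mulrA mulr_natl -[X in _ *+ X]card_ord -sumr_const.
apply: ler_sum => k _; rewrite normrM.
by apply: ler_pM; rewrite ?le_coord_mx_norm.
Qed.

Lemma norm_le_enorm (R : realType) (n : nat) (x : 'rV[R]_n) : `|x| <= enorm x.
Proof.
apply: mx_norm_le => [|i j]; first exact: sqrtr_ge0.
rewrite (ord1 i) -sqrtr_sqr ler_sqrt; last by apply: sumr_ge0 => k _; exact: sqr_ge0.
by rewrite (bigD1 j)//= lerDl sumr_ge0// => k _; exact: sqr_ge0.
Qed.

Lemma enorm_le_norm (R : realType) (n : nat) (x : 'rV[R]_n) :
  enorm x <= n%:R * `|x|.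
Proof.
rewrite -(@ler_pXn2r _ 2) ?nnegrE ?sqrtr_ge0 ?mulr_ge0//.
rewrite sqr_sqrtr; last by apply: sumr_ge0 => k _; exact: sqr_ge0.
apply: (@le_trans _ _ (n%:R * `|x| ^+ 2)).
  rewrite mulr_natl -[X in _ *+ X]card_ord -sumr_const.
  apply: ler_sum => k _; rewrite -real_normK ?num_real// ler_pXn2r ?nnegrE//.
  exact: le_coord_mx_norm.
rewrite exprMn ler_wpM2r ?sqr_ge0// -natrX ler_nat.
by case: n {x} => // n; rewrite leq_pmulr.
Qed.

Lemma enormZ (R : realType) (n : nat) (k : R) (x : 'rV[R]_n) :
  enorm (k *: x) = `|k| * enorm x.
Proof.
rewrite /enorm -sqrtr_sqr -sqrtrM ?sqr_ge0// mulr_sumr.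
by congr Num.sqrt; apply: eq_bigr => i _; rewrite mxE exprMn.
Qed.

Lemma enorm_scale_unit_ball (R : realType) (n : nat) (k : R) (x : 'rV[R]_n) :
  0 < k -> enorm x <= k -> set_scale k unit_ball x.
Proof.
move=> k0 xk; exists (k^-1 *: x); last by rewrite scalerA mulfV ?scale1r ?gt_eqF.
by rewrite /unit_ball /= enormZ gtr0_norm ?invr_gt0// mulrC ler_pdivrMr// mul1r.
Qed.

Lemma scale_unit_ball_norm (R : realType) (n : nat) (k : R) (x : 'rV[R]_n) :
  0 <= k -> set_scale k unit_ball x -> `|x| <= k.
Proof.
move=> k0 [y y1 <-]; rewrite normrZ ger0_norm// ler_piMr//.
move: y1; rewrite /unit_ball /=; apply: le_trans; exact: norm_le_enorm.
Qed.

(** Homogeneity rescales [p] to Euclidean norm 1, where the finite outer norm bounds [H]. Scaling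
    back gives a multiple of [enorm p], and the factor [m] passes to the maximum norm. *)
Lemma prefan_bounded (R : realType) (m n : nat) (H : 'rV[R]_m -> set 'rV[R]_n) :
  prefan H -> exists2 k : R, 0 <= k &
    forall (p : 'rV[R]_m) (h : 'rV[R]_n), p != 0 -> H p h -> `|h| <= k * `|p|.
Proof.
move=> [[_ homH] _ bH].
have [M HM] : exists M : R, (outer_norm H <= M%:E)%E.
  move: bH; case: (outer_norm H) => [M| |] //= _; first by exists M.
  by exists 0; rewrite leNye.
have HMe w h : enorm w <= 1 -> H w h -> enorm h <= M.
  move=> w1 Hwh; rewrite -lee_fin; apply: le_trans HM.
  apply: le_trans; last by apply: ereal_sup_ubound; exists w.
  by apply: ereal_sup_ubound; exists h.
exists (Num.max M 0 * m%:R); first by rewrite mulr_ge0// le_max lexx orbT.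
move=> p h p0 Hph.
have e0 : 0 < enorm p by apply: lt_le_trans (norm_le_enorm p); rewrite normr_gt0.
apply: le_trans (norm_le_enorm h) _.
have : enorm ((enorm p)^-1 *: h) <= M.
  apply: (HMe ((enorm p)^-1 *: p)).
    by rewrite enormZ gtr0_norm ?invr_gt0// mulVf ?gt_eqF.
  by rewrite homH ?invr_gt0//; exists h.
rewrite enormZ gtr0_norm ?invr_gt0// mulrC ler_pdivrMr// => /le_trans; apply.
rewrite -mulrA; apply: (@le_trans _ _ (Num.max M 0 * enorm p)).
  by rewrite ler_wpM2r ?(ltW e0)// le_max lexx.
by rewrite ler_wpM2l ?enorm_le_norm// le_max lexx orbT.
Qed.

(** * Steps along tangent directions *)

Lemma tangent_coneZ (R : realType) (N : nat) (C : set 'rV[R]_N) z w (k : R) :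
  0 < k -> tangent_cone C z w -> tangent_cone C z (k *: w).
Proof.
move=> k0 [y [tau [Cy yz tau0 tau_cvg yw]]].
exists y, (fun i => k^-1 * tau i); split=> //.
- by move=> i; rewrite mulr_gt0 ?invr_gt0.
- by rewrite -[X in _ --> X](mulr0 k^-1); apply: cvgM => //; exact: cvg_cst.
- under eq_fun do rewrite invfM invrK -scalerA.
  by apply: cvgZ => //; exact: cvg_cst.
Qed.

(** Along the sequences [tau] and [y] that witness the tangency of [w], the quotients of [F] tend to
    [q *m 'J F x] and those of [y] to [w]. The error divided by [tau i] therefore tends to
    [q *m 'J F x - w - p], and a late index serves. *)
Lemma tangent_step (R : realType) (n m : nat) (F : 'rV[R]_n -> 'rV[R]_m)
    (D : set 'rV[R]_m) (x q : 'rV[R]_n) (z w p : 'rV[R]_m) (e s : R) :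
  differentiable F x -> tangent_cone D z w -> 0 < s ->
  `|q *m 'J F x - w - p| < e ->
  exists tau z', [/\ 0 < tau, tau < s, D z', `|z' - z| < s &
    `|F (x + tau *: q) - z' - (F x - z) - tau *: p| <= tau * e].
Proof.
move=> dF [y [tau [Dy yz tau0 tau_cvg yw]]] s0 he.
have Fq : (tau i)^-1 *: (F (x + tau i *: q) - F x) @[i --> \oo] --> q *m 'J F x.
  rewrite -deriveEjacobian//.
  have dFq : derivable F x q by exact: diff_derivable.
  have tau0' : tau i @[i --> \oo] --> (0 : R)^'.
    move=> A A0; have := tau_cvg _ A0; rewrite !nbhs_simpl /=.
    by apply: filterS => i; apply; rewrite gt_eqF.
  have lim0 : h^-1 *: (F (h *: q + x) - F x) @[h --> (0 : R)^'] --> 'D_q F x.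
    exact: dFq.
  under eq_fun do rewrite [x + _]addrC.
  exact: cvg_comp tau0' lim0.
have lim1 : `|(tau i)^-1 *: (F (x + tau i *: q) - F x) -
    (tau i)^-1 *: (y i - z) - p| @[i --> \oo] --> `|q *m 'J F x - w - p|.
  by apply: cvg_norm; apply: cvgB; [exact: cvgB | exact: cvg_cst].
near \oo => i.
exists (tau i), (y i); split=> //.
- near: i. 
  by apply: (cvgr_lt _ tau_cvg).
- by rewrite distrC; near: i; exact: (cvgr_dist_lt _ _ yz).
- have -> : F (x + tau i *: q) - y i - (F x - z) - tau i *: p =
    tau i *: ((tau i)^-1 *: (F (x + tau i *: q) - F x) - (tau i)^-1 *: (y i - z) - p).
    rewrite !scalerBr !scalerA mulfV ?gt_eqF// !scale1r.
    by apply/matrixP => a b; rewrite !mxE; ring.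
  rewrite normrZ gtr0_norm// ler_pM2l//; apply: ltW; near: i.
  by apply: (cvgr_lt _ lim1).
Unshelve. all: by end_near.
Qed.

(* Clarke regularity transports the tangent vectors at the reference point, with
   an error proportional to the size of [p], to every nearby point of [D]. *)
Lemma regular_tangent_step (R : realType) (n m : nat)
    (F : 'rV[R]_n -> 'rV[R]_m) (D : set 'rV[R]_m) (xbar : 'rV[R]_n)
    (zbar : 'rV[R]_m) (k eps : R) :
  smooth F -> clarke_regular D zbar -> 0 <= k -> 0 < eps ->
  exists2 r : R, 0 < r &
    forall (x q : 'rV[R]_n) (z p : 'rV[R]_m) (s : R),
      `|x - xbar| < r -> D z -> `|z - zbar| < r -> p != 0 ->
      `|q| <= k * `|p| -> tangent_cone D zbar (q *m 'J F xbar - p) -> 0 < s ->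
    exists tau z', [/\ 0 < tau, tau < s, D z', `|z' - z| < s &
      `|F (x + tau *: q) - z' - (F x - z) - tau *: p| <= tau * (eps * `|p|)].
Proof.
move=> [dF cJ] regD k0 eps0.
(* Clarke regularity controls bounded tangent vectors only. This [rho] bounds the Euclidean norm of
   [q *m 'J F xbar - p] divided by [|p|]; the last 1 keeps it positive. *)
pose rho := m%:R * (n%:R * k * `|'J F xbar| + 1) + 1.
have rho0 : 0 < rho by rewrite ltr_wpDl// mulr_ge0// addr_ge0// !mulr_ge0.
have eps3 : 0 < eps / 3 by rewrite divr_gt0.
have [V Vzbar VD] := regD rho (eps / 3) rho0 eps3.
have [r1 r10 r1V] : exists2 r : R, 0 < r & forall z, `|z - zbar| < r -> V z.
  have /nbhs_ballP[r r0 rV] := Vzbar.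
  by exists r => // z zr; apply: rV; rewrite -ball_normE /= distrC.
(* Replacing ['J F xbar] by ['J F x] moves the image of [q] by at most [n k |p| e'], hence by at
   most a third of [eps |p|]. *)
pose e' := eps / 3 / (n%:R * k + 1).
have nk0 : 0 < n%:R * k + 1 by rewrite ltr_wpDl// mulr_ge0.
have e'0 : 0 < e' by rewrite divr_gt0.
have [r2 r20 r2J] : exists2 r : R, 0 < r &
    forall x, `|x - xbar| < r -> `|'J F x - 'J F xbar| <= e'.
  have /cvgrPdist_le/(_ _ e'0)/nbhs_ballP[r r0 rV] := cJ xbar.
  by exists r => // x xr; rewrite distrC; apply: rV; rewrite -ball_normE /= distrC.
exists (Num.min r1 r2); first by rewrite lt_min r10.
move=> x q z p s; rewrite !lt_min => /andP[_ xr2] Dz /andP[zr1 _] p0 qk Tw s0.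
have np0 : 0 < `|p| by rewrite normr_gt0.
(* Regularity is applied to the vector divided by [|p|]; scaling back within the cone makes the
   error proportional to [|p|]. *)
have [w [Tw' ww]] : exists w, tangent_cone D z w /\
    `|q *m 'J F xbar - p - w| <= eps / 3 * `|p|.
  have [] := VD z (conj Dz (r1V _ zr1)) (`|p|^-1 *: (q *m 'J F xbar - p)).
    split; first by apply: tangent_coneZ Tw; rewrite invr_gt0.
    apply: enorm_scale_unit_ball => //; apply: le_trans (enorm_le_norm _) _.
    rewrite /rho ler_wpDr// ler_wpM2l// normrZ gtr0_norm ?invr_gt0//.
    rewrite mulrC ler_pdivrMr// (le_trans (ler_normB _ _))// mulrDl mul1r lerD2r.
    apply: le_trans (mx_norm_mulmx _ _) _.
    rewrite -!mulrA ler_wpM2l// mulrA [leRHS](_ : _ = k * `|p| * `|'J F xbar|); last by ring.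
    by rewrite ler_wpM2r.
  move=> w1 [w2 [Tw1 w2e wE]]; exists (`|p| *: w1); split; first exact: tangent_coneZ.
  have -> : q *m 'J F xbar - p - `|p| *: w1 = `|p| *: w2.
    have -> : w2 = `|p|^-1 *: (q *m 'J F xbar - p) - w1 by rewrite wE addrC addKr.
    by rewrite scalerBr scalerA mulfV ?scale1r// gt_eqF.
  rewrite normrZ normr_id mulrC ler_wpM2r//.
  by apply: scale_unit_ball_norm w2e; exact: ltW.
apply: (tangent_step (w := w)) => //.
have -> : q *m 'J F x - w - p =
    q *m ('J F x - 'J F xbar) + (q *m 'J F xbar - p - w).
  move: ('J F x) ('J F xbar) => J J'; rewrite mulmxBr.
  by rewrite -(addrA _ (- p)) subrKA -addrA [- w - p]addrC.
apply: le_lt_trans (ler_normD _ _) _.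
have qJ : `|q *m ('J F x - 'J F xbar)| <= eps / 3 * `|p|.
  apply: le_trans (mx_norm_mulmx _ _) _.
  apply: (@le_trans _ _ (n%:R * (k * `|p|) * e')).
    by apply: ler_pM; rewrite ?mulr_ge0// ?r2J// ler_wpM2l.
  have -> : eps / 3 * `|p| = (n%:R * k + 1) * `|p| * e'.
    by rewrite /e'; field; rewrite gt_eqF.
  by rewrite ler_wpM2r ?(ltW e'0)// mulrA ler_wpM2r// lerDl.
have : 0 < eps * `|p| by rewrite mulr_gt0.
move: qJ ww; lra.
Qed.

(** * Penalized minimization over a compact set *)

Lemma compact_closedI_ball (R : realType) (n : nat) (A : set 'rV[R]_n) a (r : R) :
  closed A -> compact (A `&` [set x | `|x - a| <= r]).
Proof.
move=> clA; apply: bounded_closed_compact.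
  exists (`|a| + r); split; first exact: num_real.
  move=> M /ltW aM x [_ /= xa]; apply: le_trans aM.
  by rewrite -[x](subrK a) addrC (le_trans (ler_normD _ _))// lerD2l.
apply: closedI => //.
rewrite (_ : [set _ | _] = closed_ball_ Num.norm a r); last first.
  by apply/seteqP; split=> x; rewrite /closed_ball_ /= distrC.
exact: closed_closed_ball_.
Qed.

Lemma penalty_continuous (R : realType) (n m : nat) (F : 'rV[R]_n -> 'rV[R]_m)
    (u p : 'rV[R]_m) (x0 q : 'rV[R]_n) (c d : R) : continuous F ->
  continuous (fun v : R * 'rV[R]_n * 'rV[R]_m =>
    `|F v.1.2 - v.2 - u - v.1.1 *: p| + c * `|v.1.2 - x0 - v.1.1 *: q|
      - d * v.1.1).
Proof.
move=> cF v.
have c1 : w.1.1 @[w --> v] --> v.1.1.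
  by apply: cvg_comp (cvg_fst (F := nbhs v.1) (G := nbhs v.2)) _; exact: cvg_fst.
have c2 : w.1.2 @[w --> v] --> v.1.2.
  by apply: cvg_comp (cvg_fst (F := nbhs v.1) (G := nbhs v.2)) _; exact: cvg_snd.
have c3 : w.2 @[w --> v] --> v.2 by exact: cvg_snd.
have cFv : F w.1.2 @[w --> v] --> F v.1.2 by apply: cvg_comp c2 _; exact: cF.
apply: cvgB; [apply: cvgD|].
- apply: cvg_norm; apply: cvgB; last by apply: cvgZ => //; exact: cvg_cst.
  by apply: cvgB; [exact: cvgB|exact: cvg_cst].
- apply: cvgM; [exact: cvg_cst|]; apply: cvg_norm.
  apply: cvgB; last by apply: cvgZ => //; exact: cvg_cst.
  by apply: cvgB => //; exact: cvg_cst.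
- by apply: cvgM => //; exact: cvg_cst.
Qed.

(* [A p q] stands for: q is an admissible displacement of x for a change p of the
   parameter. *)
Lemma solution_by_minimization (R : realType) (n m : nat)
    (F : 'rV[R]_n -> 'rV[R]_m) (D : set 'rV[R]_m)
    (A : 'rV[R]_m -> 'rV[R]_n -> Prop)
    (xbar x0 q0 : 'rV[R]_n) (zbar u0 p0 : 'rV[R]_m) (k eps c d r : R) :
  continuous F -> closed D ->
  (forall (x q : 'rV[R]_n) (z p : 'rV[R]_m) (s : R),
      `|x - xbar| < r -> D z -> `|z - zbar| < r -> p != 0 -> A p q -> 0 < s ->
    exists tau z', [/\ 0 < tau, tau < s, D z', `|z' - z| < s &
      `|F (x + tau *: q) - z' - (F x - z) - tau *: p| <= tau * (eps * `|p|)]) ->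
  (forall p, p != 0 -> exists q, A p q) ->
  (forall p q, A p q -> `|q| <= k * `|p|) ->
  0 <= k -> 0 < c -> eps < d -> 0 < d -> eps + c * k < 1 ->
  p0 != 0 -> A p0 q0 -> D (F x0 - u0) ->
  (forall x, `|x - x0| <= (k + d / c) * `|p0| -> `|x - xbar| < r) ->
  (forall (x : 'rV[R]_n) z (t : R), `|x - x0| <= (k + d / c) * `|p0| ->
     0 <= t <= 1 ->
    `|F x - z - u0 - t *: p0| <= d * `|p0| -> `|z - zbar| < r) ->
  exists x, D (F x - (u0 + p0)) /\ c * `|x - x0 - q0| <= d * `|p0|.
Proof.
move=> cF clD step dir bnd k0 c0 epsd d0 epsck p00 Ap0 D0 hx hz.
have np0 : 0 < `|p0| by rewrite normr_gt0.
pose phi (v : R * 'rV[R]_n * 'rV[R]_m) :=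
  `|F v.1.2 - v.2 - u0 - v.1.1 *: p0| + c * `|v.1.2 - x0 - v.1.1 *: q0|
    - (d * `|p0|) * v.1.1.
pose K := (`[0 : R, 1] `*` (setT `&` [set x | `|x - xbar| <= r]))
  `*` (D `&` [set z | `|z - zbar| <= r]).
have inK t x z : 0 <= t <= 1 -> `|x - xbar| <= r -> D z -> `|z - zbar| <= r ->
    K (t, x, z).
  by move=> t01 xr Dz zr; split=> //=; split=> //=; rewrite in_itv.
have res00 : F x0 - (F x0 - u0) - u0 = 0 by rewrite subKr subrr.
have K0 : K (0, x0, F x0 - u0).
  have x0r : `|x0 - x0| <= (k + d / c) * `|p0|.
    by rewrite subrr normr0 mulr_ge0// addr_ge0// divr_ge0 ?ltW.
  apply: inK => //; [by rewrite lexx ler01 | exact/ltW/hx |].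
  apply/ltW/(hz x0 _ 0) => //; first by rewrite lexx ler01.
  by rewrite scale0r subr0 res00 normr0 mulr_ge0 ?ltW.
have cK : compact K.
  apply: compact_setX; last exact: compact_closedI_ball.
  apply: compact_setX; first exact: segment_compact.
  by apply: compact_closedI_ball; exact: closedT.
have [] := @compact_EVT_min _ R phi K _ cK.
- by exists (0, x0, F x0 - u0).
- by apply: continuous_subspaceT; exact: penalty_continuous.
move=> [[t x] z] /set_mem[[/= + [_ xr]] [Dz zr]] minphi.
rewrite in_itv /= => t01.
have phi0 : phi (t, x, z) <= 0.
  apply: le_trans (minphi _ (mem_set K0)) _; rewrite /phi /=.
  by rewrite !scale0r !subr0 res00 subrr !normr0 !mulr0 subr0 addr0.
rewrite /phi /= in phi0.
have t0 : 0 <= t by case/andP: t01.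
have t1 : t <= 1 by case/andP: t01.
(* Since [phi] is at most 0 at the minimizer, the reward [d |p0| t] dominates the penalty term and
   the residual separately. *)
have xq : c * `|x - x0 - t *: q0| <= d * `|p0| * t.
  by move: phi0 (normr_ge0 (F x - z - u0 - t *: p0)); lra.
have xr' : `|x - x0| <= (k + d / c) * `|p0|.
  rewrite -[x - x0](subrK (t *: q0)) (le_trans (ler_normD _ _))//.
  rewrite mulrDl addrC lerD//.
    rewrite normrZ ger0_norm// -[leRHS]mul1r.
    by apply: ler_pM => //; exact: bnd.
  rewrite -(ler_pM2l c0) (le_trans xq)//.
  rewrite (_ : c * _ = d * `|p0|); last by field; rewrite gt_eqF.
  by rewrite ler_piMr// mulr_ge0// ltW.
have {xr}xr : `|x - xbar| < r := hx _ xr'.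
have {zr}zr : `|z - zbar| < r.
  apply: (hz x _ t) => //; apply: (@le_trans _ _ (d * `|p0| * t)).
    by move: phi0 (mulr_ge0 (ltW c0) (normr_ge0 (x - x0 - t *: q0))); lra.
  by rewrite ler_piMr// mulr_ge0// ltW.
(* The minimizer lies strictly inside both balls, so short enough steps stay in [K]. Dividing by
   [|q| + 1] covers [q = 0]. *)
have steps (p : 'rV[R]_m) q s : p != 0 -> A p q -> 0 < s ->
    exists tau x' z', [/\ 0 < tau < s, x' = x + tau *: q,
      `|x' - xbar| <= r, D z' /\ `|z' - zbar| <= r &
      `|F x' - z' - (F x - z) - tau *: p| <= tau * (eps * `|p|)].
  move=> pn0 Apq s0.
  pose s1 := Num.min s (Num.min (r - `|z - zbar|) ((r - `|x - xbar|) / (`|q| + 1))).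
  have q10 : 0 < `|q| + 1 by rewrite ltr_wpDl.
  have s10 : 0 < s1 by rewrite !lt_min s0 subr_gt0 zr divr_gt0// subr_gt0.
  have [tau [z' [tau0 + Dz' + Fz']]] := step _ _ _ _ _ xr Dz zr pn0 Apq s10.
  rewrite !lt_min => /and3P[taus _ taux] /and3P[_ z'z _].
  exists tau, (x + tau *: q), z'; split; rewrite ?tau0//; last first.
    split=> //; rewrite -[z'](subrK z) -addrA (le_trans (ler_normD _ _))//.
    by move: z'z; lra.
  rewrite addrAC (le_trans (ler_normD _ _))// normrZ gtr0_norm//.
  move: taux; rewrite ltr_pdivlMr// mulrDr mulr1; lra.
(* A step along [(p0, q0)] leaves [x - x0 - t *: q0] unchanged. The residual grows by at most
   [tau eps |p0|] and the reward by [tau d |p0|], so [phi] drops. *)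
have tE : t = 1.
  apply/eqP/negPn/negP => tn1.
  have t10 : 0 < 1 - t by rewrite subr_gt0 lt_neqAle tn1.
  have [tau [x' [z' [/andP[tau0 taut] x'E x'r [Dz' z'r] Fz']]]] := steps _ _ _ p00 Ap0 t10.
  have : K (t + tau, x', z') by apply: inK => //; apply/andP; split; lra.
  move=> /mem_set/minphi; rewrite /phi /= leNgt => /negP; apply.
  have -> : x' - x0 - (t + tau) *: q0 = x - x0 - t *: q0.
    by rewrite x'E; apply/matrixP => a b; rewrite !mxE; ring.
  have : `|F x' - z' - u0 - (t + tau) *: p0| <=
      `|F x - z - u0 - t *: p0| + tau * (eps * `|p0|).
    rewrite (_ : F x' - z' - u0 - (t + tau) *: p0 = (F x - z - u0 - t *: p0) +
      (F x' - z' - (F x - z) - tau *: p0)).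
      by rewrite (le_trans (ler_normD _ _))// lerD2l.
    by apply/matrixP => a b; rewrite !mxE; ring.
  have : 0 < tau * `|p0| * (d - eps) by rewrite !mulr_gt0// subr_gt0.
  lra.
rewrite tE !scale1r mulr1 in phi0 xq.
exists x; split; last by [].
have [res0|resn0] := eqVneq (F x - z - u0 - p0) 0.
  have -> : F x - (u0 + p0) = z; last by [].
  apply/eqP; rewrite -subr_eq0 -res0; apply/eqP.
  by apply/matrixP => a b; rewrite !mxE; ring.
exfalso.
set rs := F x - z - u0 - p0 in resn0 phi0.
have nrs0 : - rs != 0 by rewrite oppr_eq0.
have [q Aq] := dir _ nrs0.
(* Here [t] stays 1. The step bound 1 makes [1 - tau] positive, so the old residual really shrinks
   by that factor. *)
have [tau [x' [z' [/andP[tau0 tau1] x'E x'r [Dz' z'r] Fz']]]] := steps _ _ _ nrs0 Aq ltr01.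
have : K (t, x', z') by apply: inK.
move=> /mem_set/minphi; rewrite /phi /= tE !scale1r -/rs leNgt => /negP; apply.
have h1 : `|F x' - z' - u0 - p0| <= (1 - tau) * `|rs| + tau * (eps * `|rs|).
  rewrite (_ : F x' - z' - u0 - p0 = (1 - tau) *: rs +
    (F x' - z' - (F x - z) - tau *: (- rs))); last first.
    by rewrite /rs; apply/matrixP => a b; rewrite !mxE; ring.
  rewrite (le_trans (ler_normD _ _))// lerD//; last by rewrite -(normrN rs).
  by rewrite normrZ ger0_norm// subr_ge0 ltW.
have h2 : c * `|x' - x0 - q0| <= c * `|x - x0 - q0| + c * (tau * (k * `|rs|)).
  rewrite -mulrDr ler_pM2l//.
  rewrite (_ : x' - x0 - q0 = (x - x0 - q0) + tau *: q); last first.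
    by rewrite x'E; apply/matrixP => a b; rewrite !mxE; ring.
  rewrite (le_trans (ler_normD _ _))// lerD2l normrZ gtr0_norm// ler_pM2l//.
  by rewrite -(normrN rs); exact: bnd.
have : 0 < tau * `|rs| * (1 - (eps + c * k)).
  by rewrite !mulr_gt0// ?normr_gt0// subr_gt0.
lra.
Qed.

(** * Choice of constants and neighborhoods *)

Theorem proposition6p1 (R : realType) (n m : nat)
    (F : 'rV[R]_n -> 'rV[R]_m) (hF : smooth F)
    (D : set 'rV[R]_m) (hD : closed D)
    (hreg : forall d : 'rV[R]_m, D d -> clarke_regular D d)
    (S : 'rV[R]_n -> set 'rV[R]_m)
    (hS : forall x : 'rV[R]_n, S x = [set F x - d | d in D])
    (xbar : 'rV[R]_n) (ubar : 'rV[R]_m) (hbar : gph S (xbar, ubar)) :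
  (forall u : 'rV[R]_m, set_inv S u = [set x | D (F x - u)]) /\
  (forall H : 'rV[R]_m -> set 'rV[R]_n,
     prefan H ->
     (forall p : 'rV[R]_m, p <> 0 ->
        exists2 q : 'rV[R]_n, [set - h | h in H (- p)] q &
          tangent_cone D (F xbar - ubar) (q *m 'J F xbar - p)) ->
     pseudo_strictly_differentiable H (set_inv S) ubar xbar).
Proof.
have invS u : set_inv S u = [set x | D (F x - u)].
  apply/seteqP; split=> x; rewrite /set_inv /= hS.
    by move=> [d Dd <-]; rewrite subKr.
  by move=> Dx; exists (F x - u); rewrite ?subKr.
split=> // H prefanH dirH; split; first exact: hbar.
move=> delta delta0.
pose zbar : 'rV[R]_m := F xbar - ubar.
have Dzbar : D zbar by have : set_inv S ubar xbar := hbar; rewrite invS.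
have [k k0 Hk] := prefan_bounded prefanH.
(* This gives [c * k <= 1 / 2], which with [eps <= 1 / 4] yields [eps + c * k < 1]. The ratio
   [d / c] is [delta] divided by [n.+1], because passing to the Euclidean norm costs a factor [n];
   the successor avoids dividing by 0 when [n = 0]. *)
pose c := (2 * (k + 1))^-1.
pose d := c * (delta / n.+1%:R).
pose eps := Num.min (1 / 4) (d / 2).
have c0 : 0 < c by rewrite invr_gt0; lra.
have d0 : 0 < d by rewrite mulr_gt0// divr_gt0.
have eps0 : 0 < eps by rewrite lt_min; apply/andP; split; lra.
have epsd : eps < d by rewrite gt_min; apply/orP; right; lra.
have epsck : eps + c * k < 1.
  have : eps <= 1 / 4 by rewrite ge_min lexx.
  have : c * k <= 1 / 2.
    by rewrite mulrC ler_pdivrMr; lra.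
  lra.
have dc : d / c = delta / n.+1%:R by rewrite /d mulrAC mulfV ?mul1r// gt_eqF.
(* Membership in [H] is left out of [A]: it matters only for the one displacement [q0], and [dirA]
   returns it separately. *)
pose A (p : 'rV[R]_m) (q : 'rV[R]_n) :=
  `|q| <= k * `|p| /\ tangent_cone D zbar (q *m 'J F xbar - p).
have dirA (p : 'rV[R]_m) : p != 0 -> exists2 q, A p q & H (- p) (- q).
  move=> p0; have [_ [h Hh <-] Th] := dirH p (elimN eqP p0).
  exists (- h); rewrite ?opprK//; split=> //.
  by rewrite normrN -(normrN p); apply: Hk => //; rewrite oppr_eq0.
have cF : continuous F by move=> x; apply: differentiable_continuous; exact: hF.1.
have [r r0 step] := regular_tangent_step xbar hF (hreg _ Dzbar) k0 eps0.
have [r2 r20 r2F] : exists2 r2 : R, 0 < r2 &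
    forall x, `|x - xbar| < r2 -> `|F x - F xbar| < r / 2.
  have r20 : 0 < r / 2 by lra.
  have /cvgrPdist_lt/(_ _ r20)/nbhs_ballP[e e0 eF] := cF xbar.
  by exists e => // x xr; rewrite distrC; apply: eF; rewrite -ball_normE /= distrC.
pose L := k + d / c.
have L0 : 0 <= L by rewrite addr_ge0// divr_ge0// ltW.
(* With [|p0| < 2 * eta], the point [x] stays within [eta + 2 L eta] of [xbar]. The distance from
   [z] to [zbar] is below [r / 2], from [F], plus [2 d eta] from the residual, [eta] from [ubar - u]
   and [2 eta] from [t *: p0]. *)
pose eta := Num.min (Num.min r r2 / (1 + 2 * L)) (r / 2 / (3 + 2 * d)).
have eta0 : 0 < eta.
  rewrite lt_min !divr_gt0//; [by lra|by rewrite lt_min r0|by lra].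
have eta1 : eta * (1 + 2 * L) <= Num.min r r2.
  by rewrite -ler_pdivlMr ?ge_min ?lexx//; lra.
have eta2 : eta * (3 + 2 * d) <= r / 2.
  by rewrite -ler_pdivlMr ?ge_min ?lexx ?orbT//; lra.
exists (ball ubar eta), (ball xbar eta); split; [exact: nbhsx_ballx..|].
move=> u u'; rewrite -!ball_normE /= => uu uu' x0 []; rewrite invS /= => Dx0 xx0.
(* For equal parameters [x0] itself works, as 0 lies in [H 0]; the minimization needs [p0 != 0]. *)
have [<-|uneq] := eqVneq u u'.
  exists x0, 0; rewrite addr0; split=> //; first by rewrite invS.
  have [[H00 _] _ _] := prefanH; rewrite subrr.
  exists 0, 0; rewrite addr0; split=> //; exists 0; rewrite ?scaler0//.
  by rewrite /unit_ball /= -(scale0r 0) enormZ normr0 mul0r.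
pose p0 := u' - u.
have p00 : p0 != 0 by rewrite subr_eq0 eq_sym.
have [q0 Ap0 Hq0] := dirA _ p00.
have p0eta : `|p0| < 2 * eta.
  have -> : p0 = (ubar - u) - (ubar - u') by rewrite opprB addrC subrKA.
  by apply: le_lt_trans (ler_normB _ _) _; lra.
have near_xbar x : `|x - x0| <= L * `|p0| -> `|x - xbar| < Num.min r r2.
  move=> xx; apply: lt_le_trans eta1.
  rewrite -[x - xbar](subrKA x0) (le_lt_trans (ler_normD _ _))//.
  have : L * `|p0| <= L * (2 * eta) by rewrite ler_wpM2l// ltW.
  by move: xx0; rewrite distrC; lra.
have [x' [Dx' xq]] :
    exists x, D (F x - (u + p0)) /\ c * `|x - x0 - q0| <= d * `|p0|.
  apply: (solution_by_minimization (A := A) (xbar := xbar) (zbar := zbar)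
    (k := k) (eps := eps) (r := r)) => //.
  - by move=> x q z p s xr Dz zr pn0 [qk Tq] s0; exact: step.
  - by move=> p /dirA[q]; exists q.
  - by move=> p q [].
  - by move=> x /near_xbar; rewrite lt_min => /andP[].
  - move=> x z t /near_xbar; rewrite lt_min => /andP[_ /r2F xF] /andP[t0 t1] res.
    have -> : z - zbar =
        (F x - F xbar) - (F x - z - u - t *: p0) + (ubar - u) - t *: p0.
      by rewrite /zbar; apply/matrixP => a b; rewrite !mxE; ring.
    apply: le_lt_trans (ler_normB _ _) _.
    have tp0 : `|t *: p0| <= `|p0| by rewrite normrZ ger0_norm// ler_piMl.
    have : d * `|p0| <= d * (2 * eta) by rewrite ler_wpM2l// ltW.
    have := ler_normD (F x - F xbar - (F x - z - u - t *: p0)) (ubar - u).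
    have := ler_normB (F x - F xbar) (F x - z - u - t *: p0).
    lra.
(* Here [- q0] lies in [H (- p0) = H (u - u')], and the remainder [x0 + q0 - x'] is absorbed by the
   ball of radius [delta * enorm (u - u')]. *)
exists x', (- q0 + (x0 + q0 - x')); split.
- by rewrite invS /=; move: Dx'; rewrite /p0 [u + _]addrC subrK.
- exists (- q0), (x0 + q0 - x'); split=> //; first by move: Hq0; rewrite opprB.
  have enp0 : `|p0| <= enorm (u - u').
    by rewrite /p0 distrC norm_le_enorm.
  have np0 : 0 < `|p0| by rewrite normr_gt0.
  apply: enorm_scale_unit_ball; first by rewrite mulr_gt0// (lt_le_trans np0).
  apply: le_trans (enorm_le_norm _) _.
  have -> : x0 + q0 - x' = - (x' - x0 - q0).
    by apply/matrixP => a b; rewrite !mxE; ring.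
  rewrite normrN; apply: (@le_trans _ _ (delta * `|p0|)); last first.
    by rewrite ler_wpM2l// ltW.
  have {}xq : `|x' - x0 - q0| <= delta / n.+1%:R * `|p0|.
    by rewrite -(ler_pM2l c0) mulrA.
  apply: (@le_trans _ _ (n.+1%:R * `|x' - x0 - q0|)).
    by rewrite ler_wpM2r// ler_nat.
  by rewrite mulrC -ler_pdivlMr// mulrAC.
- by apply/matrixP => a b; rewrite !mxE; ring.
Qed.
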